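(* Let $(M,g_{ab},F_{ab})$ be a $(1+2)$-dimensional oriented spacetime with a (sufficiently smooth) Lorentzian metric $g_{ab}$ and a (sufficiently smooth) electromagnetic field $2$-form $F_{ab}$, and let $\mu\in\mathbb{R}$ be a constant. Suppose that on $M$ the gravitational field equation $$E_{ab} = 8\pi T_{ab}, \qquad T_{ab} = \frac{1}{4\pi}\left(F_{ac}F_b{}^{c} - \frac14\, g_{ab}F_{cd}F^{cd}\right),$$ holds, where $E_{ab}$ is a diff-covariant, differentiable but otherwise arbitrary tensor-valued function of the metric, the Ricci tensor, the Levi-Civita tensor and covariant derivatives, and that the Maxwell-Chern-Simons equations $$\mathrm{d}F = 0, \qquad \mathrm{d}\,{*F} = -\mu F$$ hold. Let $\xi^a$ be a (sufficiently smooth) Killing vector field on $M$, i.e. $\mathcal{L}_\xi g_{ab}=0$, such that every point at which $\xi^a=0$ belongs to the boundary $\partial Z$ of the closed set $Z=\{p\in M : \xi^a\xi_a=0 \text{ at } p\}$. Then the symmetry is inherited by the electromagnetic field: $$\mathcal{L}_\xi F_{ab} = 0 \quad\text{on } M.$$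
   Context: Conventions. The metric has signature $(-,+,+)$, indices are raised and lowered with $g_{ab}$, $\epsilon_{abc}$ is the Levi-Civita tensor (metric volume form) of the oriented Lorentzian 3-manifold $(M,g)$, and $*$ is the Hodge dual, so that for a 2-form $({*F})_a=\frac12\,\epsilon_{abc}F^{bc}$ is a 1-form. $\mathcal{L}_\xi$ is the Lie derivative along $\xi^a$. The constant $\mu$ (the gauge Chern-Simons coupling) is any real number, including $0$. The tensor $E_{ab}$. $E_{ab}=E_{ab}[g]$ is the symmetric tensor obtained by varying a purely gravitational Lagrangian with respect to the metric. The only thing assumed about its form is that it is built, diff-covariantly and differentiably (not necessarily polynomially), from $g_{ab}$, $R_{ab}$, $\epsilon_{abc}$ and their covariant derivatives. Diff-covariance means that for every orientation-preserving (local) diffeomorphism $\varphi$ one has $\varphi^*(E[g])=E[\varphi^*g]$; in particular, $\mathcal{L}_\xi E_{ab}=0$ for every Killing vector field $\xi^a$ of $g_{ab}$. An example is $E_{ab}=G_{ab}+\Lambda g_{ab}+\lambda C_{ab}$, with $G_{ab}$ the Einstein tensor, $\Lambda,\lambda$ constants and $C_{ab}=\epsilon_a{}^{cd}\nabla_c\left(R_{db}-\frac14 R\,g_{db}\right)$ the Cotton tensor. ''Sufficiently smooth'' means differentiable to an order high enough that all the tensor fields mentioned and the derivatives of them that appear (including $\mathcal{L}_\xi F_{ab}$ and $\mathcal{L}_\xi T_{ab}$) are defined and continuous; one may take all fields to be $C^\infty$. The set $Z$ may have nonempty interior (i.e. $\xi^a$ may be null on an open region), and $F_{ab}$ may vanish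 on some part of $M$. *)

(* Defs.v *)
From HB Require Import structures.
From mathcomp Require Import all_boot all_order all_algebra.
From mathcomp Require Import all_classical all_reals all_analysis.

Set Implicit Arguments.
Unset Strict Implicit.
Unset Printing Implicit Defensive.
Import Order.TTheory GRing.Theory Num.Theory.
Import numFieldNormedType.Exports.
Local Open Scope classical_set_scope.
Local Open Scope ring_scope.

(** Conventions.  A point of R^3, a vector and a 1-form are row vectors; a
    covariant 2-tensor is the matrix of its components.  [ 'J phi x ] acts on
    row vectors on the right, so its (i, j) entry is d phi^j / d x^i. *)

Section Calculus.
Context {R : realType}.

Definition pd {W : normedModType R} (i : 'I_3) (f : 'rV[R]_3 -> W)
    (x : 'rV[R]_3) : W :=
  'D_(delta_mx 0 i) f x.

Fixpoint times_diff_on {W : normedModType R} (k : nat) (U : set 'rV[R]_3)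
    (f : 'rV[R]_3 -> W) : Prop :=
  if k is k'.+1 then
    (forall x, U x -> differentiable f x) /\
    (forall i : 'I_3, times_diff_on k' U (pd i f))
  else forall x, U x -> {for x, continuous f}.

(** C^infinity; only used for open [U]. *)
Definition smooth_on {W : normedModType R} (U : set 'rV[R]_3)
    (f : 'rV[R]_3 -> W) : Prop :=
  forall k, times_diff_on k U f.

Definition pullback2 (phi : 'rV[R]_3 -> 'rV[R]_3) (T : 'rV[R]_3 -> 'M[R]_3)
    (x : 'rV[R]_3) : 'M[R]_3 :=
  'J phi x *m T (phi x) *m ('J phi x)^T.

(** Symmetric of signature (-,+,+); symmetry follows from the congruence. *)
Definition lorentzian (A : 'M[R]_3) : Prop :=
  exists2 P : 'M[R]_3, P \in unitmx &
    P *m A *m P^T = diag_mx (\row_(i < 3) (if i == 0 then - 1 else 1)).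

Definition lorentz_metric_on (U : set 'rV[R]_3) (g : 'rV[R]_3 -> 'M[R]_3) :=
  smooth_on U g /\ (forall x, U x -> lorentzian (g x)).

(** Lie derivatives along [xi] of a covariant 2-tensor:
    xi^c d_c T_ab + (d_a xi^c) T_cb + (d_b xi^c) T_ac. *)
Definition lie2 (xi : 'rV[R]_3 -> 'rV[R]_3) (T : 'rV[R]_3 -> 'M[R]_3)
    (x : 'rV[R]_3) : 'M[R]_3 :=
  \matrix_(a < 3, b < 3) \sum_(c < 3)
    (xi x 0 c * pd c (fun y => T y a b) x
     + pd a (fun y => xi y 0 c) x * T x c b
     + pd b (fun y => xi y 0 c) x * T x a c).

Definition d_1form (w : 'rV[R]_3 -> 'rV[R]_3) (x : 'rV[R]_3) : 'M[R]_3 :=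
  \matrix_(a < 3, b < 3)
    (pd a (fun y => w y 0 b) x - pd b (fun y => w y 0 a) x).

Definition d_2form (F : 'rV[R]_3 -> 'M[R]_3) (x : 'rV[R]_3)
    (a b c : 'I_3) : R :=
  pd a (fun y => F y b c) x + pd b (fun y => F y c a) x
  + pd c (fun y => F y a b) x.

End Calculus.

Section LorentzianGeometry.
Context {R : realType}.

(** The alternating symbol with [012] = 1. *)
Definition alt_symbol (a b c : 'I_3) : R :=
  \det (\matrix_(r < 3, s < 3) (tnth [tuple a; b; c] r == s)%:R).

(** Components of the metric volume form in a positively oriented chart. *)
Definition epsilon (A : 'M[R]_3) (a b c : 'I_3) : R :=
  Num.sqrt `|\det A| * alt_symbol a b c.

(** F^{ab} = g^{ac} g^{bd} F_{cd} *)
Definition raise2 (A F : 'M[R]_3) : 'M[R]_3 := invmx A *m F *m (invmx A)^T.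

Definition hodge2 (A F : 'M[R]_3) : 'rV[R]_3 :=
  \row_(a < 3)
    (2^-1 * \sum_(b < 3) \sum_(c < 3) epsilon A a b c * raise2 A F b c).

Definition em_stress (A F : 'M[R]_3) : 'M[R]_3 :=
  (4 * pi)^-1 *:
    (F *m invmx A *m F^T
     - (4^-1 * \sum_(c < 3) \sum_(d < 3) F c d * raise2 A F c d) *: A).

(** Gamma^a_{bc} *)
Definition christoffel (g : 'rV[R]_3 -> 'M[R]_3) (a b c : 'I_3)
    (x : 'rV[R]_3) : R :=
  2^-1 * \sum_(d < 3) invmx (g x) a d *
    (pd b (fun y => g y d c) x + pd c (fun y => g y d b) x
     - pd d (fun y => g y b c) x).

(** R_{bd} = R^a_{bad} *)
Definition ricci (g : 'rV[R]_3 -> 'M[R]_3) (b d : 'I_3) (x : 'rV[R]_3) : R :=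
  \sum_(a < 3)
    (pd a (christoffel g a b d) x - pd d (christoffel g a b a) x
     + \sum_(e < 3)
         (christoffel g a a e x * christoffel g e b d x
          - christoffel g a d e x * christoffel g e b a x)).

(** Covariant derivative of a covariant tensor of rank n; the differentiation
    index comes first. *)
Definition cov_deriv (g : 'rV[R]_3 -> 'M[R]_3) (n : nat)
    (T : n.-tuple 'I_3 -> 'rV[R]_3 -> R)
    (I : n.+1.-tuple 'I_3) (x : 'rV[R]_3) : R :=
  let c := thead I in
  let J : n.-tuple 'I_3 := behead_tuple I in
  pd c (T J) x
  - \sum_(k < n) \sum_(d < 3)
      christoffel g d c (tnth J k) x *
      T [tuple if l == k then d else tnth J l | l < n] x.

Fixpoint cov_deriv_ricci (g : 'rV[R]_3 -> 'M[R]_3) (k : nat) :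
    k.+2.-tuple 'I_3 -> 'rV[R]_3 -> R :=
  match k return k.+2.-tuple 'I_3 -> 'rV[R]_3 -> R with
  | 0 => fun I => ricci g (tnth I 0) (tnth I 1)
  | k'.+1 => cov_deriv g (cov_deriv_ricci g (k := k'))
  end.

End LorentzianGeometry.

Section GravityTensor.
Context (R : realType).

(** Component labels of the arguments g_ab, eps_abc and nabla^k Ric, k <= N.
    (The covariant derivatives of g and eps vanish identically.) *)
Definition geom_idx (N : nat) : finType :=
  ('I_3 * 'I_3 + 3.-tuple 'I_3 + {k : 'I_N.+1 & k.+2.-tuple 'I_3})%type.

Definition geom_entry (N : nat) (g : 'rV[R]_3 -> 'M[R]_3) (x : 'rV[R]_3)
    (l : geom_idx N) : R :=
  match l with
  | inl (inl ab) => g x ab.1 ab.2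
  | inl (inr abc) => epsilon (g x) (tnth abc 0) (tnth abc 1) (tnth abc 2)
  | inr kI => cov_deriv_ricci g (tagged kI) x
  end.

Definition geom_data (N : nat) (g : 'rV[R]_3 -> 'M[R]_3) (x : 'rV[R]_3) :
    'rV[R]_#|geom_idx N| :=
  \row_(j < #|geom_idx N|) geom_entry g x (enum_val j).

(** A tensor-valued function g |-> E_ab[g] built differentiably from g, eps,
    Ric and finitely many covariant derivatives.  It may be only partially
    defined (as 1/R is); [gt_dom] is its domain.  Diff-covariance is required
    for metrics on open subsets of R^3, with [phi] any orientation-preserving
    local diffeomorphism; applied to chart transitions, this makes E[g] a
    well-defined tensor on every oriented Lorentzian 3-manifold. *)
Record gravity_tensor := GravityTensor {
  gt_order : nat;
  gt_dom : set 'rV[R]_#|geom_idx gt_order|;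
  gt_fun : 'rV[R]_#|geom_idx gt_order| -> 'M[R]_3;
  gt_dom_open : open gt_dom;
  gt_differentiable : forall u, gt_dom u -> differentiable gt_fun u;
  gt_symmetric : forall (U : set 'rV[R]_3) (g : 'rV[R]_3 -> 'M[R]_3),
    open U -> lorentz_metric_on U g ->
    forall x, U x -> gt_dom (geom_data gt_order g x) ->
    (gt_fun (geom_data gt_order g x))^T = gt_fun (geom_data gt_order g x);
  gt_covariant : forall (U V : set 'rV[R]_3) (g : 'rV[R]_3 -> 'M[R]_3)
      (phi : 'rV[R]_3 -> 'rV[R]_3),
    open U -> open V -> lorentz_metric_on U g ->
    (forall x, U x -> gt_dom (geom_data gt_order g x)) ->
    smooth_on V phi -> (forall y, V y -> U (phi y)) ->
    (forall y, V y -> 0 < \det ('J phi y)) ->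
    forall y, V y ->
      gt_dom (geom_data gt_order (pullback2 phi g) y) /\
      gt_fun (geom_data gt_order (pullback2 phi g) y)
        = pullback2 phi (gt_fun \o geom_data gt_order g) y }.

Definition gt_defined_at (E : gravity_tensor) (g : 'rV[R]_3 -> 'M[R]_3)
    (x : 'rV[R]_3) : Prop :=
  gt_dom (geom_data (gt_order E) g x).

(** The components E_ab[g] at x. *)
Definition gt_eval (E : gravity_tensor) (g : 'rV[R]_3 -> 'M[R]_3)
    (x : 'rV[R]_3) : 'M[R]_3 :=
  gt_fun (geom_data (gt_order E) g x).

End GravityTensor.

Section OrientedManifold.
Context (R : realType).

Record chart (M : topologicalType) := Chart {
  cdom : set M;
  cmap : M -> 'rV[R]_3;
  cinv : 'rV[R]_3 -> M;
  cdom_open : open cdom;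
  cimg_open : open (cmap @` cdom);
  cmapK : forall p, cdom p -> cinv (cmap p) = p;
  cmap_continuous : forall p, cdom p -> {for p, continuous cmap};
  cinv_continuous : forall x, (cmap @` cdom) x -> {for x, continuous cinv} }.

Definition cimg (M : topologicalType) (c : chart M) : set 'rV[R]_3 :=
  cmap c @` cdom c.

Definition transition (M : topologicalType) (c c' : chart M) :
    'rV[R]_3 -> 'rV[R]_3 :=
  cmap c' \o cinv c.

(** Smooth 3-manifolds, oriented by an atlas whose transition maps have
    positive Jacobian determinant. *)
Record oriented_manifold3 := OrientedManifold3 {
  carrier :> topologicalType;
  om_hausdorff : hausdorff_space carrier;
  om_second_countable : second_countable (T := carrier);
  atlas_index : Type;
  atlas : atlas_index -> chart carrier;
  atlas_cover : forall p : carrier, exists i, cdom (atlas i) p;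
  atlas_smooth : forall i j,
    smooth_on (cmap (atlas i) @` (cdom (atlas i) `&` cdom (atlas j)))
      (transition (atlas i) (atlas j));
  atlas_oriented : forall i j p,
    cdom (atlas i) p -> cdom (atlas j) p ->
    0 < \det ('J (transition (atlas i) (atlas j)) (cmap (atlas i) p)) }.

End OrientedManifold.

(** Tensor fields on a manifold are families of components, one per chart of
    the atlas, related by the transformation law on overlaps.  The values of
    the components outside the image of the chart are irrelevant. *)
Section TensorFields.
Context {R : realType} (M : oriented_manifold3 R).

Definition cov2_family := atlas_index M -> 'rV[R]_3 -> 'M[R]_3.
Definition vec_family := atlas_index M -> 'rV[R]_3 -> 'rV[R]_3.

Definition smooth_cov2_field (T : cov2_family) : Prop :=
  (forall i, smooth_on (cimg (atlas i)) (T i)) /\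
  (forall i j p, cdom (atlas i) p -> cdom (atlas j) p ->
     T i (cmap (atlas i) p)
     = pullback2 (transition (atlas i) (atlas j)) (T j) (cmap (atlas i) p)).

Definition smooth_vector_field (xi : vec_family) : Prop :=
  (forall i, smooth_on (cimg (atlas i)) (xi i)) /\
  (forall i j p, cdom (atlas i) p -> cdom (atlas j) p ->
     xi j (cmap (atlas j) p)
     = xi i (cmap (atlas i) p)
         *m 'J (transition (atlas i) (atlas j)) (cmap (atlas i) p)).

Definition lorentzian_metric (g : cov2_family) : Prop :=
  smooth_cov2_field g /\
  (forall i x, cimg (atlas i) x -> lorentzian (g i x)).

Definition smooth_2form (F : cov2_family) : Prop :=
  smooth_cov2_field F /\
  (forall i x, cimg (atlas i) x -> (F i x)^T = - F i x).

Definition gravity_eq (E : gravity_tensor R) (g F : cov2_family) : Prop :=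
  forall i x, cimg (atlas i) x ->
    gt_defined_at E (g i) x /\
    gt_eval E (g i) x = (8 * pi) *: em_stress (g i x) (F i x).

Definition maxwell_chern_simons (mu : R) (g F : cov2_family) : Prop :=
  forall i x, cimg (atlas i) x ->
    (forall a b c, d_2form (F i) x a b c = 0) /\
    d_1form (fun y => hodge2 (g i y) (F i y)) x = - mu *: F i x.

Definition killing (g : cov2_family) (xi : vec_family) : Prop :=
  forall i x, cimg (atlas i) x -> lie2 (xi i) (g i) x = 0.

Definition vanishes_at (xi : vec_family) (p : M) : Prop :=
  forall i, cdom (atlas i) p -> xi i (cmap (atlas i) p) = 0.

Definition lightlike_set (g : cov2_family) (xi : vec_family) : set M :=
  [set p | forall i, cdom (atlas i) p ->
     let x := cmap (atlas i) p in xi i x *m g i x *m (xi i x)^T = 0].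

End TensorFields.

Definition frontier {T : topologicalType} (A : set T) : set T :=
  closure A `\` interior A.

(* Main.v *)
Require Import Defs.
From mathcomp Require Import all_boot all_order all_algebra.
From mathcomp Require Import all_classical all_reals all_analysis.
From mathcomp Require Import ring lra.
Import Order.TTheory GRing.Theory Num.Theory.
Import numFieldNormedType.Exports.
Local Open Scope classical_set_scope.
Local Open Scope ring_scope.

Set Implicit Arguments.
Unset Strict Implicit.
Unset Printing Implicit Defensive.

(** In a chart, put phi_t(y) = y + t xi(y).  This is not the flow of xi, but it
    is an orientation-preserving local diffeomorphism for small t, and since
    L_xi g = 0 all partial derivatives of phi_t^* g have vanishing t-derivative
    at t = 0.  Hence so have the Christoffel symbols, the Ricci tensor and its
    covariant derivatives, and by the chain rule E[phi_t^* g], which equals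
    phi_t^* E[g] by covariance.  Thus xi need not be integrated.

    On the other side, phi_t^* T = T[phi_t^* g, phi_t^* F], so with
    H = L_xi F, G = g^-1 the equation becomes H G F^T + F G H^T = c g for some
    scalar c.  Diagonalising g, this forces H = 0 wherever F <> 0.  If H were
    nonzero at some point, it would be nonzero nearby by continuity, so F would
    vanish nearby, whence H = 0 there. *)

(** * Symmetry of mixed derivatives *)

Section MixedDerivatives.
Context {R : realType} {V : normedModType R}.
Implicit Types (f : V -> R) (x v w : V).

Lemma is_derive_line f x v (t : R) :
  differentiable f (x + t *: v) ->
  is_derive t 1 (fun s => f (x + s *: v)) ('D_v f (x + t *: v)).
Proof.
move=> df.
have dl : is_diff t (fun s : R => x + s *: v) ( *:%R ^~ v).
  apply: (@is_diff_eq _ _ _ (cst x + *:%R^~ v)); last by rewrite add0r.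
have dc : differentiable (f \o (fun s => x + s *: v)) t.
  by apply: differentiable_comp => //; apply: ex_diff.
apply: DeriveDef; first exact: diff_derivable.
rewrite [LHS]deriveE // [X in X 1 = _]diff_comp //= diff_val scale1r.
by rewrite deriveE.
Qed.

(* Mean value theorem along v, then differentiability of 'D_v f at x. *)
Lemma second_difference f x v w (e : R) :
  (\forall y \near x, differentiable f y) ->
  differentiable (fun y => 'D_v f y) x -> 0 < e ->
  exists2 d, 0 < d & forall s, 0 < s -> s < d ->
    `|(f (x + s *: v + s *: w) - f (x + s *: v)) - (f (x + s *: w) - f x)
      - s ^+ 2 * 'D_w ('D_v f) x| <= e * s ^+ 2.
Proof.
move=> df dvf e0.
(* The two remainders will add up to at most e s times 2(|v| + |w|) / C, so this choice keeps the
   sum below e s; the summand 1 makes [C] positive even for v = w = 0. *)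
pose C : R := 2 * (`|v| + `|w|) + 1.
have C0 : 0 < C by rewrite ltr_wpDl// mulr_ge0// addr_ge0.
have Cvw : `|v| + `|w| < C.
  by rewrite /C; have := normr_ge0 v; have := normr_ge0 w; lra.
pose L := 'd (fun y => 'D_v f y) x.
have /eqaddoP/(_ (e / C)) : (fun y => 'D_v f y) \o shift x
    = cst ('D_v f x) + L +o_ (0 : V) id by exact: diff_locally.
rewrite divr_gt0 // => /(_ isT) nL.
have : \forall h \near (0 : V), differentiable f (h + x) /\
    `|(((fun y => 'D_v f y) \o shift x) - (cst ('D_v f x) + L)) h|
      <= e / C * `|h|.
  near=> h; split; last by near: h; exact: nL.
  near: h; move: df; rewrite (near_shift 0 x) subr0.
  by apply: filterS => h /=.
move=> /nbhs_ballP[r /= r0 hr].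
exists (r / C); first by rewrite divr_gt0.
move=> s s0 sd.
have small a b : 0 <= a <= s -> 0 <= b <= s ->
    ball (0 : V) r (a *: v + b *: w).
  move=> /andP[a0 a1] /andP[b0 b1]; rewrite -ball_normE /ball_/= sub0r normrN.
  apply: (le_lt_trans (ler_normD _ _)); rewrite !normrZ (ger0_norm a0)(ger0_norm b0).
  apply: (@le_lt_trans _ _ (s * `|v| + s * `|w|)).
    by rewrite lerD // ler_wpM2r.
  rewrite -mulrDr; apply: (@le_lt_trans _ _ (s * C)).
    by rewrite ler_wpM2l // ltW.
  by rewrite -ltr_pdivlMr.
have ss : 0 <= s <= s by rewrite lexx ltW.
have zs : 0 <= (0 : R) <= s by rewrite lexx ltW.
(* The second difference is [phi s - phi 0]; the mean value theorem turns it into s times a value of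
   [dphi]. *)
pose phi (t : R) := f (x + s *: w + t *: v) - f (x + t *: v).
pose dphi (t : R) := 'D_v f (x + s *: w + t *: v) - 'D_v f (x + t *: v).
have dph t : t \in `[0, s]%R -> is_derive t 1 phi (dphi t).
  rewrite in_itv /= => ts; apply: is_deriveB; apply: is_derive_line.
    have [+ _] := hr _ (small _ _ ts ss).
    by rewrite [X in differentiable _ X](_ : _ = x + s *: w + t *: v)//
       addrC [in RHS]addrAC addrA.
  have [+ _] := hr _ (small _ _ ts zs).
  by rewrite scale0r addr0 addrC.
have dph' (t : R) : t \in `]0, s[%R -> is_derive t 1 phi (dphi t).
  by rewrite in_itv /= => /andP[t0 t1]; apply: dph; rewrite in_itv/= !ltW.
have cph : {within `[0, s], continuous phi}.
  apply: continuous_in_subspaceT => t; rewrite inE => ts.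
  apply/differentiable_continuous/derivable1_diffP.
  by have [] := dph t ts.
have [t ts phs] := MVT s0 dph' cph.
have ts' : 0 <= t <= s by move: ts; rewrite in_itv/= => /andP[? ?]; rewrite !ltW.
have {phs} : phi s - phi 0 = dphi t * s by rewrite phs subr0.
rewrite {1 2}/phi !scale0r !addr0 => phs.
rewrite (_ : x + s *: v + s *: w = x + s *: w + s *: v); last by rewrite addrAC.
rewrite phs.
have [_ /=] := hr _ (small _ _ ts' ss).
rewrite /= -[(_ - _) _]/(_ - (_ + _)) /= => h1.
have [_ /=] := hr _ (small _ _ ts' zs).
rewrite /= -[(_ - _) _]/(_ - (_ + _)) /= scale0r addr0 => h2.
have Dw : 'D_w ('D_v f) x = L w by rewrite deriveE.
rewrite Dw.
have nv : `|t *: v| <= s * (`|v| + `|w|).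
  rewrite normrZ mulrDr; have /andP[t0 t1] := ts'; rewrite (ger0_norm t0).
  by rewrite -[leLHS]addr0 lerD ?ler_wpM2r ?mulr_ge0 // ltW.
have nvw : `|t *: v + s *: w| <= s * (`|v| + `|w|).
  apply: (le_trans (ler_normD _ _)).
  rewrite !normrZ mulrDr; have /andP[t0 t1] := ts'.
  by rewrite (ger0_norm t0) (gtr0_norm s0) lerD // ler_wpM2r.
move: h1 h2.
have -> : L (t *: v + s *: w) = L (t *: v) + s * L w.
  by rewrite /L linearD; congr (_ + _); rewrite linearZ.
rewrite (_ : t *: v + s *: w + x = x + s *: w + t *: v); last first.
  by rewrite addrC addrAC addrA.
rewrite (_ : t *: v + x = x + t *: v) ; last by rewrite addrC.
set A := 'D_v f (x + s *: w + t *: v); set B := 'D_v f (x + t *: v).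
set K := L w; set K' := L (t *: v); set D := 'D_v f x => h1 h2.
have eC : 0 <= e / C by rewrite divr_ge0 // ltW.
have h1' := le_trans h1 (ler_wpM2l eC nvw).
have h2' := le_trans h2 (ler_wpM2l eC nv).
rewrite /dphi -/A -/B.
(* The unknown mean value point t enters the linear parts only through L (t v), which occurs in both
   expansions and cancels, leaving s L w. *)
have -> : (A - B) * s - s ^+ 2 * K
    = s * ((A - (D + (K' + s * K))) - (B - (D + K'))) by ring.
rewrite normrM (gtr0_norm s0).
rewrite (_ : e * s ^+ 2 = s * (e * s)); last by ring.
rewrite ler_pM2l //.
apply: (le_trans (ler_normB _ _)); apply: (le_trans (lerD h1' h2')).
have -> : e / C * (s * (`|v| + `|w|)) + e / C * (s * (`|v| + `|w|))
    = e * s * ((2 * (`|v| + `|w|)) / C) by ring.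
rewrite ler_piMr ?mulr_ge0 ?ltW // ltr_pdivrMr // mul1r /C.
by rewrite ltrDl.
Unshelve. all: by end_near. Qed.

(** The second difference is symmetric in v and w, so both mixed derivatives approximate it: s^2
    times their gap is at most e s^2 for small s, with e arbitrary. *)
Lemma derive_comm f x v w :
  (\forall y \near x, differentiable f y) ->
  differentiable (fun y => 'D_v f y) x -> differentiable (fun y => 'D_w f y) x ->
  'D_w ('D_v f) x = 'D_v ('D_w f) x.
Proof.
move=> df dv dw; apply/eqP; rewrite -subr_eq0 -normr_le0.
apply/ler_addgt0Pr => e e0; rewrite add0r.
have e20 : 0 < e / 2 by rewrite divr_gt0.
have [d1 d10 h1] := second_difference w df dv e20.
have [d2 d20 h2] := second_difference v df dw e20.
pose s := Num.min d1 d2 / 2.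
have m0 : 0 < Num.min d1 d2 by rewrite lt_min d10.
have s0 : 0 < s by rewrite /s divr_gt0.
have sm : s < Num.min d1 d2 by rewrite /s ltr_pdivrMr // ltr_pMr // ltr1n.
move: sm; rewrite lt_min => /andP[s1 s2].
have {}h1 := h1 s s0 s1; have {}h2 := h2 s s0 s2.
move: h1 h2; rewrite [x + s *: v + s *: w]addrAC.
set A := f _; set B := f _; set C := f (x + s *: w).
set P := 'D_w _ _; set Q := 'D_v ('D_w f) x => h1 h2.
have s20 : 0 < s ^+ 2 by rewrite exprn_gt0.
rewrite -(ler_pM2l s20) -[X in X * _](gtr0_norm s20) -normrM.
have -> : s ^+ 2 * (P - Q) = (A - C - (B - f x) - s ^+ 2 * Q)
   - (A - B - (C - f x) - s ^+ 2 * P) by ring.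
apply: (le_trans (ler_normB _ _)).
by apply: (le_trans (lerD h2 h1)); rewrite -mulrDl -splitr mulrC.
Qed.

End MixedDerivatives.

(** * Calculus of smooth functions on open subsets of R^3 *)

Section SmoothFunctions.
Context {R : realType}.
Implicit Types (U V : set 'rV[R]_3) (x y : 'rV[R]_3).

(** The first-order expansion of f at x is also one of g, and uniqueness of the differential
    identifies ['d g x] with ['d f x]. *)
Lemma near_eq_differentiable {W1 W2 : normedModType R} (f g : W1 -> W2)
    (x : W1) :
  (\near x, f x = g x) -> differentiable f x -> differentiable g x.
Proof.
move=> fg /diff_locallyP[cf ef].
suff eg : g \o shift x = cst (g x) + 'd f x +o_ (0 : W1) id.
  by apply/diff_locallyP; rewrite (diff_unique cf eg).
apply/eqaddoP => e e0; move/eqaddoP : ef => /(_ e e0) ef.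
have gx : f x = g x := nbhs_singleton fg.
have fg0 : \forall h \near (0 : W1), f (h + x) = g (h + x).
  by move: fg; rewrite (near_shift 0 x) subr0.
near=> h.
have : `|(f \o shift x - (cst (f x) + 'd f x)) h| <= e * `|id h|.
  by near: h.
rewrite -![(_ - _) h]/(_ - (_ + _)) /= gx.
by have -> // : f (h + x) = g (h + x) by near: h.
Unshelve. all: by end_near. Qed.

Lemma near_open U x (P : 'rV[R]_3 -> Prop) :
  open U -> U x -> (forall y, U y -> P y) -> \forall y \near x, P y.
Proof.
by move=> oU Ux UP; apply: filterS UP _; exact: open_nbhs_nbhs.
Qed.

Lemma pd_eq {W : normedModType R} U (f g : 'rV[R]_3 -> W) i x :
  open U -> (forall y, U y -> f y = g y) -> U x -> pd i f x = pd i g x.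
Proof.
by move=> oU fg Ux; apply: near_eq_derive; exact: (near_open oU Ux).
Qed.

(** On an open set, pointwise equality is equality near each point, so it passes to partial
    derivatives of every order. *)
Lemma times_diff_on_eq {W : normedModType R} k U (f g : 'rV[R]_3 -> W) :
  open U -> (forall y, U y -> f y = g y) ->
  times_diff_on k U f -> times_diff_on k U g.
Proof.
move=> oU; elim: k f g => [|k IH] f g fg /=.
  move=> cf x Ux.
  have fgx : {near x, f =1 g} by exact: (near_open oU Ux).
  rewrite /prop_for /continuous_at -(fg _ Ux).
  exact: (cvg_trans (near_eq_cvg fgx) (cf x Ux)).
move=> [df kf]; split=> [x Ux|i].
  by apply: near_eq_differentiable (df x Ux); exact: (near_open oU Ux).
by apply: IH (kf i) => y Uy; exact: pd_eq Uy.
Qed.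

Lemma smooth_on_pd {W : normedModType R} U (f : 'rV[R]_3 -> W) i :
  smooth_on U f -> smooth_on U (pd i f).
Proof. by move=> sf k; have [_] := sf k.+1; exact. Qed.

Lemma smooth_on_differentiable {W : normedModType R} U (f : 'rV[R]_3 -> W) x :
  smooth_on U f -> U x -> differentiable f x.
Proof. by move=> sf; have [df _] := sf 1%N; exact: df. Qed.

Lemma smooth_on_derivable {W : normedModType R} U (f : 'rV[R]_3 -> W) x v :
  smooth_on U f -> U x -> derivable f x v.
Proof. by move=> sf Ux; exact/diff_derivable/(smooth_on_differentiable sf). Qed.

Lemma smooth_on_continuous {W : normedModType R} U (f : 'rV[R]_3 -> W) x :
  smooth_on U f -> U x -> {for x, continuous f}.
Proof. by move=> sf; exact: (sf 0%N). Qed.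

Lemma smooth_on_subset {W : normedModType R} U V (f : 'rV[R]_3 -> W) :
  V `<=` U -> smooth_on U f -> smooth_on V f.
Proof.
move=> VU sf k; move: (sf k); elim: k f {sf} => [|k IH] f /=.
  by move=> cf x /VU; exact: cf.
by move=> [df kf]; split=> [x /VU|i]; [exact: df|exact: IH].
Qed.

Lemma smooth_onD {W : normedModType R} U (f g : 'rV[R]_3 -> W) :
  open U -> smooth_on U f -> smooth_on U g ->
  smooth_on U (fun y => f y + g y).
Proof.
move=> oU sf sg k; elim: k f g sf sg => [|k IH] f g sf sg /=.
  by move=> x Ux; apply: continuousD; exact: smooth_on_continuous Ux.
split=> [x Ux|i].
  by apply: differentiableD; exact: smooth_on_differentiable Ux.
apply: (@times_diff_on_eq _ _ _ (fun y => pd i f y + pd i g y)) => //.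
  by move=> y Uy; apply/esym/deriveD; exact: smooth_on_derivable Uy.
by apply: IH; exact: smooth_on_pd.
Qed.

Lemma smooth_on_cst {W : normedModType R} U (c : W) :
  smooth_on U (fun _ : 'rV[R]_3 => c).
Proof.
move=> k; elim: k c => [|k IH] c /=; first by move=> x _; exact: cst_continuous.
split=> [x _|i]; first exact: differentiable_cst.
have -> : pd i (fun _ : 'rV[R]_3 => c) = fun=> 0.
  by apply/funext => y; exact: derive_cst.
exact: IH.
Qed.

Lemma smooth_onZ {W : normedModType R} U (c : R) (f : 'rV[R]_3 -> W) :
  open U -> smooth_on U f -> smooth_on U (fun y => c *: f y).
Proof.
move=> oU sf k; elim: k f sf => [|k IH] f sf /=.
  move=> x Ux; apply: continuousZr; exact: smooth_on_continuous Ux.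
split=> [x Ux|i].
  by apply: differentiableZ; exact: smooth_on_differentiable Ux.
apply: (@times_diff_on_eq _ _ _ (fun y => c *: pd i f y)) => //.
  by move=> y Uy; apply/esym/deriveZ; exact: smooth_on_derivable Uy.
by apply: IH; exact: smooth_on_pd.
Qed.

Lemma smooth_on_id U : smooth_on U (fun y : 'rV[R]_3 => y).
Proof.
case=> [|k] /=; first by move=> x _; exact: cvg_id.
split=> [x _|i]; first exact: ex_diff.
have -> : pd i (fun y : 'rV[R]_3 => y) = fun=> delta_mx 0 i.
  by apply/funext => y; exact: derive_id.
exact: smooth_on_cst.
Qed.

Lemma derive_coord {W : normedModType R} m n (f : W -> 'M[R]_(m, n)) (x v : W) a b :
  derivable f x v -> 'D_v (fun z => f z a b) x = 'D_v f x a b.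
Proof. by move=> df; rewrite derive_mx // mxE. Qed.

Lemma smooth_on_coord m n U (f : 'rV[R]_3 -> 'M[R]_(m, n)) a b :
  open U -> smooth_on U f -> smooth_on U (fun y => f y a b).
Proof.
move=> oU sf k; elim: k f sf => [|k IH] f sf /=.
  move=> x Ux; apply: (@continuous_comp _ _ _ f (fun A => A a b)).
    exact: smooth_on_continuous Ux.
  exact: coord_continuous.
split=> [x Ux|i].
  apply: (@differentiable_comp _ _ _ _ f (fun A => A a b)).
    exact: smooth_on_differentiable Ux.
  exact: differentiable_coord.
apply: (@times_diff_on_eq _ _ _ (fun y => pd i f y a b)) => //.
  by move=> y Uy; apply/esym/derive_coord; exact: smooth_on_derivable Uy.
by apply: IH; exact: smooth_on_pd.
Qed.

Lemma pd_comm U (f : 'rV[R]_3 -> R) i j x :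
  open U -> smooth_on U f -> U x -> pd i (pd j f) x = pd j (pd i f) x.
Proof.
move=> oU sf Ux; apply: derive_comm.
- by apply: (near_open oU Ux) => y; exact: smooth_on_differentiable.
- exact: (smooth_on_differentiable (smooth_on_pd j sf) Ux).
- exact: (smooth_on_differentiable (smooth_on_pd i sf) Ux).
Qed.

Lemma derive_rowE (f : 'rV[R]_3 -> R) x (v : 'rV[R]_3) :
  differentiable f x -> 'D_v f x = \sum_(i < 3) v 0 i * pd i f x.
Proof.
move=> df; rewrite deriveE // [in LHS](row_sum_delta v) linear_sum.
by apply: eq_bigr => i _; rewrite linearZ /= /pd deriveE.
Qed.

End SmoothFunctions.

(** * One-parameter families of functions *)

Section Variations.
Context {R : realType} (V : set 'rV[R]_3) (oV : open V) (d : R) (d0 : 0 < d).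
Implicit Types (u v w : R -> 'rV[R]_3 -> R) (f : 'rV[R]_3 -> R).

(* For every partial derivative D of order at most k, D u_t has derivative D f
   at t = 0 throughout V, so that f is d/dt u_t at t = 0 in the C^k sense. *)
Fixpoint variation (k : nat) u f : Prop :=
  (forall x, V x -> is_derive (0 : R) (1 : R) (u ^~ x) (f x)) /\
  if k is k'.+1 then
    [/\ forall t x i, `|t| < d -> V x -> derivable (u t) x (delta_mx 0 i),
        forall x i, V x -> derivable f x (delta_mx 0 i) &
        forall i : 'I_3, variation k' (fun t => pd i (u t)) (pd i f)]
  else True.

Lemma variation_derive k u f x :
  variation k u f -> V x -> is_derive (0 : R) (1 : R) (u ^~ x) (f x).
Proof. by case: k => [|k] [du _]; exact: du. Qed.

Lemma variationS k u f : variation k.+1 u f -> variation k u f.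
Proof.
elim: k u f => [|k IH] u f [du [cu cf pu]]; split=> //.
by split=> // i; exact/IH/pu.
Qed.

Let near0 (P : R -> Prop) : (forall t, `|t| < d -> P t) -> \forall t \near 0, P t.
Proof.
move=> dP; apply/nbhs_ballP; exists d => // t.
by rewrite -ball_normE /ball_/= sub0r normrN => /dP.
Qed.

(** Derivatives at t = 0 see only small t, and partial derivatives see only the open set V. This
    allows a family to be replaced by a product or sum formula valid for small t. *)
Lemma variation_eq k u v f g :
  (forall t x, `|t| < d -> V x -> u t x = v t x) ->
  (forall x, V x -> f x = g x) -> variation k u f -> variation k v g.
Proof.
elim: k u v f g => [|k IH] u v f g uv fg [du]; last move=> [cu cf pu].
  split=> // x Vx; rewrite -fg //.
  by apply: near_eq_is_derive (du x Vx); apply: near0 => t td; exact: uv.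
split=> [x Vx|].
  rewrite -fg //.
  by apply: near_eq_is_derive (du x Vx); apply: near0 => t td; exact: uv.
split=> [t x i td Vx|x i Vx|i].
- apply: near_eq_derivable (cu t x i td Vx).
  by apply: (near_open oV Vx) => y Vy; exact: uv.
- by apply: near_eq_derivable (cf x i Vx); exact: (near_open oV Vx).
- apply: IH (pu i) => [t x td Vx|x Vx].
    by apply: (pd_eq _ oV _ Vx) => y Vy; exact: uv.
  exact: (pd_eq _ oV _ Vx).
Qed.

Lemma variation_cst k (c : R) : variation k (fun _ _ => c) (fun _ => 0).
Proof.
elim: k c => [|k IH] c; first by split=> // x _; exact: is_derive_cst.
split=> [x _|]; first exact: is_derive_cst.
split=> [t x i _ _|x i _|i]; [exact: derivable_cst|exact: derivable_cst|].
by apply: variation_eq (IH 0) => [t x _ _|x _]; exact/esym/derive_cst.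
Qed.

Lemma variation_static k f :
  smooth_on V f -> variation k (fun=> f) (fun _ => 0).
Proof.
elim: k f => [|k IH] f sf; first by split=> // x _; exact: is_derive_cst.
split=> [x _|]; first exact: is_derive_cst.
split=> [t x i _ Vx|x i _|i].
- exact: smooth_on_derivable Vx.
- exact: derivable_cst.
- have := IH _ (smooth_on_pd i sf).
  by apply: variation_eq => // x _; exact/esym/derive_cst.
Qed.

Lemma variationD k u v f g : variation k u f -> variation k v g ->
  variation k (fun t x => u t x + v t x) (fun x => f x + g x).
Proof.
elim: k u v f g => [|k IH] u v f g [du du'] [dv dv'].
  by split=> // x Vx; apply: is_deriveD; [exact: du|exact: dv].
split=> [x Vx|]; first by apply: is_deriveD; [exact: du|exact: dv].
move: du' dv' => [cu cf pu] [cv cg pv]; split=> [t x i td Vx|x i Vx|i].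
- by apply: derivableD; [exact: cu|exact: cv].
- by apply: derivableD; [exact: cf|exact: cg].
- apply: variation_eq (IH _ _ _ _ (pu i) (pv i)) => [t x td Vx|x Vx].
    by apply/esym/deriveD; [exact: cu|exact: cv].
  by apply/esym/deriveD; [exact: cf|exact: cg].
Qed.

Lemma variationM k u v f g : variation k u f -> variation k v g ->
  variation k (fun t x => u t x * v t x) (fun x => f x * v 0 x + u 0 x * g x).
Proof.
have h0 u' v' f' g' x : is_derive (0 : R) (1 : R) (u' ^~ x) (f' x) ->
    is_derive (0 : R) (1 : R) (v' ^~ x) (g' x) ->
    is_derive (0 : R) (1 : R) (fun t : R => u' t x * v' t x : R)
      (f' x * v' 0 x + u' 0 x * g' x : R).
  move=> du dv; apply: (is_derive_eq (is_deriveM du dv)).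
  by rewrite /GRing.scale /= addrC [_ * f' x]mulrC.
elim: k u v f g => [|k IH] u v f g [du du'] [dv dv'].
  by split=> // x Vx; apply: h0; [exact: du|exact: dv].
split=> [x Vx|]; first by apply: h0; [exact: du|exact: dv].
move: du' dv' => [cu cf pu] [cv cg pv].
have z0 : `|0 : R| < d by rewrite normr0.
split=> [t x i td Vx|x i Vx|i].
- by apply: derivableM; [exact: cu|exact: cv].
- apply: derivableD; apply: derivableM.
  + exact: cf.
  + exact: cv.
  + exact: cu.
  + exact: cg.
(* By the Leibniz rule [pd i] of the product is a sum of two products, each with one
   undifferentiated factor; that factor is needed at order k only. *)
- have ul : variation k u f by apply: variationS.
  have vl : variation k v g by apply: variationS.
  have := variationD (IH _ _ _ _ (pu i) vl) (IH _ _ _ _ ul (pv i)).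
  apply: variation_eq => [t x td Vx|x Vx].
    rewrite /pd deriveM; [|exact: cu|exact: cv].
    by rewrite /GRing.scale /= addrC [_ * v t x]mulrC.
  rewrite /pd deriveD; last 2 first.
    by apply: derivableM; [exact: cf|exact: cv].
    by apply: derivableM; [exact: cu|exact: cg].
  rewrite !deriveM; [|exact: cu|exact: cg|exact: cf|exact: cv].
  by rewrite /GRing.scale /=; ring.
Qed.

Lemma variation_sum k (I : finType) (u : I -> R -> 'rV[R]_3 -> R)
    (f : I -> 'rV[R]_3 -> R) : (forall i, variation k (u i) (f i)) ->
  variation k (fun t x => \sum_i u i t x) (fun x => \sum_i f i x).
Proof.
move=> uf; elim: (index_enum I) => [|i s IH].
  by apply: variation_eq (variation_cst k 0) => *; rewrite big_nil.
by apply: variation_eq (variationD (uf i) IH) => *; rewrite big_cons.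
Qed.

(** First-order constancy at t = 0 in the C^infinity sense. Including all orders makes the property
    stable under [pd] as well as under algebra, hence under the whole construction of curvature from
    the metric. *)
Definition stationary u := forall k, variation k u (fun=> 0).

Lemma stationary_eq u v :
  (forall t x, `|t| < d -> V x -> u t x = v t x) ->
  stationary u -> stationary v.
Proof. by move=> uv su k; apply: variation_eq (su k). Qed.

Lemma stationary_cst c : stationary (fun _ _ => c).
Proof. by move=> k; exact: variation_cst. Qed.

Lemma stationaryD u v : stationary u -> stationary v ->
  stationary (fun t x => u t x + v t x).
Proof.
move=> su sv k; apply: variation_eq (variationD (su k) (sv k)) => // x _.
by rewrite addr0.
Qed.

Lemma stationaryM u v : stationary u -> stationary v ->
  stationary (fun t x => u t x * v t x).
Proof.
move=> su sv k; apply: variation_eq (variationM (su k) (sv k)) => // x _.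
by rewrite mul0r mulr0 addr0.
Qed.

Lemma stationaryN u : stationary u -> stationary (fun t x => - u t x).
Proof.
move=> su; apply: stationary_eq (stationaryM (stationary_cst (- 1)) su).
by move=> *; rewrite mulN1r.
Qed.

Lemma stationaryB u v : stationary u -> stationary v ->
  stationary (fun t x => u t x - v t x).
Proof. by move=> su sv; apply: stationaryD => //; exact: stationaryN. Qed.

Lemma stationary_sum (I : finType) (u : I -> R -> 'rV[R]_3 -> R) :
  (forall i, stationary (u i)) -> stationary (fun t x => \sum_i u i t x).
Proof.
move=> su; elim: (index_enum I) => [|i s IH].
  by apply: stationary_eq (stationary_cst 0) => *; rewrite big_nil.
by apply: stationary_eq (stationaryD (su i) IH) => *; rewrite big_cons.
Qed.

Lemma stationary_prod (I : finType) (u : I -> R -> 'rV[R]_3 -> R) :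
  (forall i, stationary (u i)) -> stationary (fun t x => \prod_i u i t x).
Proof.
move=> su; elim: (index_enum I) => [|i s IH].
  by apply: stationary_eq (stationary_cst 1) => *; rewrite big_nil.
by apply: stationary_eq (stationaryM (su i) IH) => *; rewrite big_cons.
Qed.

Lemma stationary_pd i u : stationary u -> stationary (fun t => pd i (u t)).
Proof.
move=> su k; have [_ [_ _ /(_ i)]] := su k.+1.
by apply: variation_eq => // x _; exact: derive_cst.
Qed.

Lemma stationaryV u : (forall t x, `|t| < d -> V x -> u t x != 0) ->
  stationary u -> stationary (fun t x => (u t x)^-1).
Proof.
move=> u0 su k.
have z0 : `|0 : R| < d by rewrite normr0.
have h0 x : V x -> is_derive (0 : R) (1 : R) (fun t : R => (u t x)^-1 : R) 0.
  move=> Vx; have [du e] := variation_derive (su 0) Vx.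
  apply: DeriveDef; first by apply: derivableV => //; exact: u0.
  by rewrite deriveV ?e ?scaler0 //; exact: u0.
elim: k => [|k IH]; first by split.
split; first exact: h0; split=> [t x i td Vx|x i _|i].
- apply: derivableV; first exact: u0.
  by have [_ [cu _ _]] := su 1%N; exact: cu.
- exact: derivable_cst.
(* This is the formula pd (1/u) = - (pd u) (1/u) (1/u), with the induction hypothesis used for both
   factors 1/u. *)
- have := variationM (stationary_pd i su k) (variationM IH IH).
  move=> /(variationM (variation_cst k (- 1))).
  apply: variation_eq => [t x td Vx|x Vx]; last first.
    by rewrite /pd derive_cst; ring.
  rewrite /pd [RHS]deriveV; [|exact: u0|].
    by rewrite /GRing.scale /=; field; exact: u0.
  by have [_ [cu _ _]] := su 1%N; exact: cu.
Qed.

Lemma stationary_det n (A : R -> 'rV[R]_3 -> 'M[R]_n) :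
  (forall i j, stationary (fun t x => A t x i j)) ->
  stationary (fun t x => \det (A t x)).
Proof.
move=> sA; apply: stationary_sum => s; apply: stationaryM.
  exact: stationary_cst.
by apply: stationary_prod => i; exact: sA.
Qed.

(** By Cramer's rule each entry of the inverse is a cofactor divided by the determinant. *)
Lemma stationary_invmx n (A : R -> 'rV[R]_3 -> 'M[R]_n) :
  (forall t x, `|t| < d -> V x -> A t x \in unitmx) ->
  (forall i j, stationary (fun t x => A t x i j)) ->
  forall i j, stationary (fun t x => invmx (A t x) i j).
Proof.
move=> uA sA i j.
apply: (@stationary_eq (fun t x => (\det (A t x))^-1 *
    ((-1) ^+ (j + i) * \det (row' j (col' i (A t x)))))).
  move=> t x td Vx; rewrite /invmx uA // !mxE /cofactor.
  by [].
apply: stationaryM.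
  apply: stationaryV; last exact: stationary_det.
  by move=> t x td Vx; have := uA t x td Vx; rewrite unitmxE unitfE.
apply: stationaryM; first exact: stationary_cst.
apply: stationary_det => a b.
by apply: stationary_eq (sA (lift j a) (lift i b)) => t x _ _; rewrite !mxE.
Qed.

End Variations.

(** * First-order constancy of the volume form, the Ricci tensor and its covariant derivatives *)

Section GeometryVariation.
Context {R : realType} (V : set 'rV[R]_3) (oV : open V) (d : R) (d0 : 0 < d).
Context (G : R -> 'rV[R]_3 -> 'M[R]_3).
Context (unitG : forall t x, `|t| < d -> V x -> G t x \in unitmx).
Context (stationaryG : forall a b, stationary V d (fun t x => G t x a b)).

Lemma stationary_christoffel a b c :
  stationary V d (fun t => christoffel (G t) a b c).
Proof.
apply: stationaryM => //; first exact: stationary_cst.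
apply: stationary_sum => // e; apply: stationaryM => //.
  exact: stationary_invmx.
apply: stationaryB => //; [apply: stationaryD => //|];
  exact: (stationary_pd _ _ _ (stationaryG _ _)).
Qed.

Lemma stationary_ricci a b : stationary V d (fun t => ricci (G t) a b).
Proof.
apply: stationary_sum => // e; apply: stationaryD => //.
  by apply: stationaryB => //; apply: stationary_pd => //; exact: stationary_christoffel.
apply: stationary_sum => // f.
by apply: stationaryB => //; apply: stationaryM => //; exact: stationary_christoffel.
Qed.

Lemma stationary_cov_deriv_ricci k I :
  stationary V d (fun t => cov_deriv_ricci (G t) (k := k) I).
Proof.
elim: k I => [|k IH] I; first exact: stationary_ricci.
apply: stationaryB => //; first by exact: stationary_pd.
apply: stationary_sum => // j; apply: stationary_sum => // e.
by apply: stationaryM => //; exact: stationary_christoffel.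
Qed.

Lemma is_derive_geom_entry N (l : geom_idx N) x : V x ->
  is_derive (0 : R) (1 : R) (fun t => geom_entry (G t) x l) 0.
Proof.
move=> Vx; case: l => [[[a b]|I]|[k I]] /=.
- exact: (variation_derive (stationaryG a b 0%N) Vx).
- have z0 : `|0 : R| < d by rewrite normr0.
  have det0 : \det (G 0 x) != 0 by rewrite -unitfE -unitmxE; exact: unitG.
  have sdet := stationary_det oV d0 stationaryG.
  have dD := variation_derive (sdet 0%N) Vx.
  suff : is_derive (0 : R) (1 : R) (fun t : R => Num.sqrt `|\det (G t x)| : R) 0.
    move=> ds; rewrite /epsilon.
    have := is_deriveM ds (is_derive_cst
      (alt_symbol (tnth I 0) (tnth I 1) (tnth I 2)) (0 : R) (1 : R)).
    by move=> /is_derive_eq; apply; rewrite !scaler0 addr0.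
  (* The absolute value is removed before differentiating: the determinant is nonzero at t = 0, so
     it keeps its sign [s] nearby and its absolute value is [s] times it. *)
  pose s : R := Num.sg (\det (G 0 x)).
  have sD : is_derive (0 : R) (1 : R) (fun t : R => s * \det (G t x) : R) 0.
    have := is_deriveM (is_derive_cst s (0 : R) (1 : R)) dD.
    by move=> /is_derive_eq; apply; rewrite !scaler0 addr0.
  have s0 : 0 < s * \det (G 0 x).
    by rewrite -normrEsg normr_gt0.
  have := @is_derive1_comp _ _ (fun t : R => s * \det (G t x)) 0 _ _
    (is_derive1_sqrt s0) sD.
  rewrite mulr0; apply: near_eq_is_derive.
  have cD : {for 0, continuous (fun t : R => s * \det (G t x))}.
    apply/differentiable_continuous/derivable1_diffP.
    exact: (@ex_derive _ _ _ _ _ _ _ sD).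
  have : \forall t \near 0, 0 < s * \det (G t x).
    exact: (cvgr_gt _ cD _ s0).
  apply: filterS => t /= st; congr (Num.sqrt _).
  rewrite -(gtr0_norm st) normrM /s normr_sg det0 mul1r.
  by [].
- exact: (variation_derive (@stationary_cov_deriv_ricci k I 0%N) Vx).
Qed.

End GeometryVariation.

(** * Pullback along y + t xi(y) and the Lie derivative *)

Section InfinitesimalFlow.
Context {R : realType} (U V : set 'rV[R]_3) (oU : open U) (oV : open V).
Context (d : R) (d0 : 0 < d) (xi : 'rV[R]_3 -> 'rV[R]_3).
Context (sxi : smooth_on V xi).

Definition displace (t : R) (y : 'rV[R]_3) : 'rV[R]_3 := y + t *: xi y.

Context (displaceU : forall t y, `|t| < d -> V y -> U (displace t y)).

Let z0 : `|0 : R| < d. Proof. by rewrite normr0. Qed.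

Lemma displace0 y : displace 0 y = y.
Proof. by rewrite /displace scale0r addr0. Qed.

Lemma displace_subset : V `<=` U.
Proof. by move=> y Vy; rewrite -(displace0 y); exact: displaceU. Qed.

Let sxi_coord j : smooth_on V (fun y => xi y 0 j).
Proof. exact: smooth_on_coord. Qed.

Lemma smooth_on_displace t : smooth_on V (displace t).
Proof. by apply: smooth_onD => //; [exact: smooth_on_id|exact: smooth_onZ]. Qed.

(** The Jacobian entries of [displace t], written as an explicit affine function of t so that their
    variation can be read off. *)
Definition jac (i j : 'I_3) (t : R) (y : 'rV[R]_3) : R :=
  (i == j)%:R + t * pd i (fun z => xi z 0 j) y.

Lemma pd_displace i j t y :
  V y -> pd i (displace t) y 0 j = jac i j t y.
Proof.
move=> Vy; have dxi : derivable xi y (delta_mx 0 i) := smooth_on_derivable sxi Vy.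
rewrite /pd deriveD; [|exact: derivable_id|exact: derivableZ].
by rewrite derive_id deriveZ // !mxE eqxx /= eq_sym -derive_coord.
Qed.

Lemma jacobian_displace i j t y : V y -> 'J (displace t) y i j = jac i j t y.
Proof.
move=> Vy; rewrite -pd_displace // /pd deriveEjacobian.
  by rewrite -rowE [RHS]mxE.
exact: smooth_on_differentiable (smooth_on_displace t) Vy.
Qed.

Lemma variation_jac k i j :
  variation V d k (jac i j) (fun y => pd i (fun z => xi z 0 j) y).
Proof.
have vt : variation V d k (fun t _ => t) (fun _ => 1).
  have hd := is_derive_id (0 : R) (1 : R).
  case: k => [|k]; split=> //; split=> [t x l _ _|x l _|l].
  - exact: derivable_cst.
  - exact: derivable_cst.
  - apply: (variation_eq oV d0 _ _ (variation_cst oV d0 k 0)) => *;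
      exact/esym/derive_cst.
have := variationM oV d0 vt (variation_static oV d0 k (smooth_on_pd i (sxi_coord j))).
move=> /(variationD oV d0 (variation_cst oV d0 k (i == j)%:R)).
by apply: variation_eq => // x Vx; rewrite add0r mul1r mul0r addr0.
Qed.

Lemma sum_delta (i : 'I_3) (f : 'I_3 -> R) : \sum_j f j * (i == j)%:R = f i.
Proof.
rewrite (bigD1 i) //= eqxx mulr1 big1 ?addr0 // => j ji.
by rewrite eq_sym (negbTE ji) mulr0.
Qed.

Lemma jac0 i j y : jac i j 0 y = (i == j)%:R.
Proof. by rewrite /jac mul0r addr0. Qed.

Lemma pd_comp_displace (h : 'rV[R]_3 -> R) i t y :
  smooth_on U h -> `|t| < d -> V y ->
  pd i (h \o displace t) y = \sum_j pd j h (displace t y) * jac i j t y.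
Proof.
move=> sh td Vy.
have dh : differentiable h (displace t y).
  by apply: smooth_on_differentiable sh _; exact: displaceU.
have dp : differentiable (displace t) y.
  exact: smooth_on_differentiable (smooth_on_displace t) Vy.
rewrite /pd deriveE; last exact: differentiable_comp.
rewrite diff_comp //= -(deriveE _ dp) -(deriveE _ dh).
rewrite derive_rowE //; apply: eq_bigr => j _.
by rewrite -pd_displace // mulrC.
Qed.

(** The Lie derivative of a scalar function, which is the t-derivative at 0 of [h \o displace t]. *)
Definition lie0 (h : 'rV[R]_3 -> R) (y : 'rV[R]_3) : R :=
  \sum_e xi y 0 e * pd e h y.

Lemma derivable_lie0_term (h : 'rV[R]_3 -> R) e y v : smooth_on U h -> V y ->
  derivable (fun z => xi z 0 e * pd e h z) y v.
Proof.
move=> sh Vy; have Uy := displace_subset Vy; apply: derivableM.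
  exact: smooth_on_derivable (sxi_coord e) Vy.
exact: smooth_on_derivable (smooth_on_pd e sh) Uy.
Qed.

(** Leibniz rule, followed by symmetry of the mixed derivatives of h. The right-hand side is what
    differentiating the chain rule for [h \o displace t] in t produces, so d/dt at 0 commutes with
    [pd i]. *)
Lemma pd_lie0 (h : 'rV[R]_3 -> R) i y : smooth_on U h -> V y ->
  pd i (lie0 h) y = lie0 (pd i h) y
    + \sum_j pd j h y * pd i (fun z => xi z 0 j) y.
Proof.
move=> sh Vy; have Uy := displace_subset Vy.
have -> : lie0 h = \sum_e (fun z => xi z 0 e * pd e h z).
  by apply/funext => z; rewrite fct_sumE.
rewrite /pd derive_sum; last by move=> e; exact: derivable_lie0_term.
rewrite -big_split; apply: eq_bigr => e _ /=.
rewrite deriveM; last 2 first.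
- exact: smooth_on_derivable (sxi_coord e) Vy.
- exact: smooth_on_derivable (smooth_on_pd e sh) Uy.
by rewrite -!/(pd _ _ _) -!/(pd _ _) (pd_comm i e oU sh Uy).
Qed.

(** The chain rule writes a partial derivative of [h \o displace t] as a sum of
    [pd j h \o displace t] times Jacobian entries. The induction therefore runs over all smooth h at
    once and is applied to each [pd j h]. *)
Lemma variation_displace k (h : 'rV[R]_3 -> R) : smooth_on U h ->
  variation V d k (fun t => h \o displace t) (lie0 h).
Proof.
have h0 g y : smooth_on U g -> V y ->
    is_derive (0 : R) (1 : R) (fun t => g (displace t y)) (lie0 g y).
  move=> sg Vy; have Uy := displace_subset Vy.
  have dg := smooth_on_differentiable sg Uy.
  have := @is_derive_line _ _ g y (xi y) 0.
  by rewrite -/(displace 0 y) displace0 /lie0 -derive_rowE //; exact.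
elim: k h => [|k IH] h sh; first by split=> // y Vy; exact: h0.
split=> [y Vy|]; first exact: h0.
split=> [t y i td Vy|y i Vy|i].
- apply/diff_derivable/differentiable_comp.
    exact: smooth_on_differentiable (smooth_on_displace t) Vy.
  by apply: smooth_on_differentiable sh _; exact: displaceU.
- have -> : lie0 h = \sum_e (fun z => xi z 0 e * pd e h z).
    by apply/funext => z; rewrite fct_sumE.
  by apply: derivable_sum => e; exact: derivable_lie0_term.
- have := variation_sum oV d0 (fun j : 'I_3 => variationM oV d0
    (IH _ (smooth_on_pd j sh)) (variation_jac k i j)).
  apply: variation_eq => // [t y td Vy|y Vy]; first by rewrite -pd_comp_displace.
  rewrite pd_lie0 // big_split /=; congr (_ + _).
    rewrite -[RHS](sum_delta i (fun j => lie0 (pd j h) y)).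
    by apply: eq_bigr => j _; rewrite jac0.
  by apply: eq_bigr => j _; rewrite displace0.
Qed.

(** Product rule on Jacobian, tensor, Jacobian. At t = 0 the Jacobians are Kronecker deltas, so the
    tensor factor gives the transport term of [lie2] and each Jacobian gives one of the other
    two. *)
Lemma variation_pullback2 k (T : 'rV[R]_3 -> 'M[R]_3) a b : smooth_on U T ->
  variation V d k (fun t y => pullback2 (displace t) T y a b)
    (fun y => lie2 xi T y a b).
Proof.
move=> sT.
have sTc i j : smooth_on U (fun y => T y i j) by exact: smooth_on_coord.
have := variation_sum oV d0 (fun j : 'I_3 => variationM oV d0
  (variation_sum oV d0 (fun i : 'I_3 => variationM oV d0
    (variation_jac k a i) (variation_displace k (sTc i j))))
  (variation_jac k b j)).
apply: variation_eq => // [t y td Vy|y Vy].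
  rewrite [RHS]mxE; apply: eq_bigr => j _.
  rewrite [X in _ = X * _]mxE [X in _ = _ * X]mxE jacobian_displace //.
  by congr (_ * _); apply: eq_bigr => i _; rewrite jacobian_displace.
pose D i j := pd i (fun z => xi z 0 j) y.
transitivity (\sum_j ((\sum_i D a i * T y i j + lie0 (fun z => T z a j) y)
    * (b == j)%:R + T y a j * D b j)).
  apply: eq_bigr => j _; rewrite jac0 big_split /=; congr (_ * _ + _ * _).
    congr (_ + _); first by apply: eq_bigr => i _; rewrite displace0.
    rewrite -[RHS](sum_delta a (fun i => lie0 (fun z => T z i j) y)).
    by apply: eq_bigr => i _; rewrite jac0 mulrC.
  rewrite -[RHS](sum_delta a (fun i => T y i j)).
  by apply: eq_bigr => i _; rewrite jac0 mulrC /= displace0.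
rewrite big_split /= sum_delta mxE !big_split /=.
rewrite [X in _ = X + _]addrC; congr (_ + _).
by apply: eq_bigr => j _; rewrite mulrC.
Qed.

End InfinitesimalFlow.

(** * The stress tensor *)

Section StressAlgebra.
Context {R : realType}.
Implicit Types A F H J P : 'M[R]_3.

Lemma invmx_congr J A : J \in unitmx -> A \in unitmx ->
  invmx (J *m A *m J^T) = (invmx J)^T *m invmx A *m invmx J.
Proof.
move=> uJ uA.
have uT : J^T \in unitmx by rewrite unitmx_tr.
have uB : J *m A *m J^T \in unitmx by rewrite !unitmx_mul uJ uA uT.
have e : (invmx J)^T *m invmx A *m invmx J *m (J *m A *m J^T) = 1%:M.
  by rewrite !mulmxA !mulmxKV // trmx_inv mulVmx.
by rewrite -[RHS](mulmxK uB) e mul1mx.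
Qed.

(** With K = [raise2 A F] this is the scalar F_cd F^cd; its form as a trace makes invariance under
    change of basis a matter of cyclicity. *)
Definition pairing (F K : 'M[R]_3) : R := \sum_(c < 3) \sum_(e < 3) F c e * K c e.

Lemma pairingE (F K : 'M[R]_3) : pairing F K = \tr (F *m K^T).
Proof.
rewrite /mxtrace; apply: eq_bigr => c _; rewrite !mxE.
by apply: eq_bigr => e _; rewrite mxE.
Qed.

Lemma raise2_congr J A F : J \in unitmx -> A \in unitmx ->
  raise2 (J *m A *m J^T) (J *m F *m J^T)
    = (invmx J)^T *m raise2 A F *m invmx J.
Proof.
move=> uJ uA; rewrite /raise2 invmx_congr // !trmx_mul trmxK !mulmxA.
have uT : J^T \in unitmx by rewrite unitmx_tr.
by rewrite !trmx_inv mulmxKV // mulmxK.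
Qed.

(** The stress tensor is algebraic in metric and field, and every contraction pairs a [J] with its
    inverse. With [J] the Jacobian, this says that pullback commutes with forming the stress
    tensor. *)
Lemma em_stress_congr J A F : J \in unitmx -> A \in unitmx ->
  em_stress (J *m A *m J^T) (J *m F *m J^T) = J *m em_stress A F *m J^T.
Proof.
move=> uJ uA; have uT : J^T \in unitmx by rewrite unitmx_tr.
rewrite /em_stress -!/(pairing _ _) raise2_congr // invmx_congr //.
have -> : pairing (J *m F *m J^T) ((invmx J)^T *m raise2 A F *m invmx J)
    = pairing F (raise2 A F).
  move: (raise2 A F) => K; rewrite !pairingE !trmx_mul trmxK !mulmxA.
  rewrite !trmx_inv mulmxK //.
  by rewrite mxtrace_mulC !mulmxA mulVmx // mul1mx.
rewrite -scalemxAr -scalemxAl; congr (_ *: _).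
rewrite mulmxBr mulmxBl -scalemxAr -scalemxAl; congr (_ - _).
rewrite !trmx_mul trmxK !mulmxA trmx_inv.
by rewrite mulmxK // mulmxKV.
Qed.

(** The Minkowski metric, spelled as in [lorentzian] so that the diagonalisation there rewrites to
    it directly. *)
Definition eta : 'M[R]_3 := diag_mx (\row_(i < 3) (if i == 0 then - 1 else 1)).

Lemma antisym_mxE F : F^T = - F ->
  (forall i, F i i = 0) /\ (forall i j, F j i = - F i j).
Proof.
move=> aF; have aE i j : F j i = - F i j.
  by have /matrixP/(_ i j) := aF; rewrite !mxE.
split=> // i; have := aE i i; lra.
Qed.

Lemma sum3 (f : 'I_3 -> R) : \sum_i f i = f 0 + f 1 + f 2.
Proof.
by rewrite !big_ord_recl big_ord0 addr0 addrA; congr (f _ + f _ + f _); apply/val_inj.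
Qed.

Lemma eta_product F H i j :
  (H *m eta *m F^T) i j = - (H i 0 * F j 0) + H i 1 * F j 1 + H i 2 * F j 2.
Proof.
rewrite mxE sum3 !mxE !sum3 !mxE /=; ring.
Qed.

(** In dimension three F and H are dual to vectors f and h, and the equation says that the symmetric
    product of f and h is a multiple of the metric. The product has rank at most 2 and the metric
    rank 3, so the product vanishes and with it f or h. The proof carries this out on the six
    components. *)
Lemma eta_sym_product_eq0 F H (c : R) : F^T = - F -> H^T = - H ->
  H *m eta *m F^T + F *m eta *m H^T = c *: eta -> F != 0 -> H = 0.
Proof.
move=> /antisym_mxE[Fd Fa] /antisym_mxE[Hd Ha] e F0.
have {e}e i j : (- (H i 0 * F j 0) + H i 1 * F j 1 + H i 2 * F j 2)
    + (- (F i 0 * H j 0) + F i 1 * H j 1 + F i 2 * H j 2) = c * eta i j.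
  by rewrite -!eta_product; have /matrixP/(_ i j) := e; rewrite !mxE.
have ord3 (i : 'I_3) : [\/ i = 0, i = 1 | i = 2].
  by case: i => [[|[|[|]]]] //= h;
    [constructor 1|constructor 2|constructor 3]; exact/val_inj.
have mx3 (M : 'M[R]_3) : (forall i, M i i = 0) -> (forall i j, M j i = - M i j) ->
    M 0 1 = 0 -> M 0 2 = 0 -> M 1 2 = 0 -> M = 0.
  move=> Md Ma M01 M02 M12; apply/matrixP => i j; rewrite mxE.
  by case: (ord3 i) => ->; case: (ord3 j) => ->; rewrite ?Md ?M01 ?M02 ?M12 //
    Ma ?M01 ?M02 ?M12 oppr0.
move: (e 0 0) (e 1 1) (e 2 2) (e 0 1) (e 0 2) (e 1 2) => {e}.
rewrite !(Fd, Hd) (Fa 0 1) (Fa 0 2) (Fa 1 2) (Ha 0 1) (Ha 0 2) (Ha 1 2) !mxE /=.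
rewrite !(mulr1n, mulr0n) => e00 e11 e22 e01 e02 e12.
have [f0|f0] : (F 0 1 = 0 /\ F 0 2 = 0 /\ F 1 2 = 0) \/
    [|| F 0 1 != 0, F 0 2 != 0 | F 1 2 != 0].
  have [f1|] := eqVneq (F 0 1) 0; last by right.
  have [f2|] := eqVneq (F 0 2) 0; last by right; rewrite orbT.
  have [f3|] := eqVneq (F 1 2) 0; last by right; rewrite !orbT.
  by left.
  by case: f0 => ? [? ?]; move: F0; rewrite (mx3 F) ?eqxx.
have : H 0 1 = 0 /\ H 0 2 = 0 /\ H 1 2 = 0; last by case=> ? [? ?]; exact: mx3.
move: (F 0 1) (F 0 2) (F 1 2) (H 0 1) (H 0 2) (H 1 2) f0 e00 e11 e22 e01 e02 e12.
move=> p q r x y z f0 e00 e11 e22 e01 e02 e12.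
(* Eliminating c from the three diagonal equations gives the first two relations; the off-diagonal
   equations, where [eta] is 0, give the other three. *)
have xp : x * p = y * q by lra.
have zr : z * r = - (x * p) by lra.
have yr : y * r = - (q * z) by lra.
have xr : x * r = - (p * z) by lra.
have xq : x * q = - (p * y) by lra.
(* If x is nonzero, the relations give x (p^2 + q^2) = 0, hence p = q = 0 over the reals, and then x
   r^2 = 0, so that p, q, r would all vanish. *)
have x0 : x = 0.
  apply/eqP; apply: contraT => xn0.
  have /eqP : x * (p ^+ 2 + q ^+ 2) = 0.
    by rewrite mulrDr !expr2 (mulrA x q) xq mulrA xp; ring.
  rewrite mulf_eq0 (negbTE xn0) paddr_eq0 ?sqr_ge0 // !sqrf_eq0 => /andP[/eqP p0 /eqP q0].
  have /eqP : x * r ^+ 2 = 0 by rewrite expr2 mulrA xr p0; ring.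
  rewrite mulf_eq0 (negbTE xn0) sqrf_eq0 /= => /eqP r0.
  by rewrite p0 q0 r0 eqxx in f0.
rewrite x0 in xp zr xr xq; rewrite !mul0r ?oppr0 in xp zr xr xq.
have yr0 : y * (r * r) = 0 by rewrite mulrA yr mulNr -mulrA zr; ring.
have /eqP : y * r = 0.
  have /eqP := yr0; rewrite !mulf_eq0 orbb => /orP[|] /eqP ->.
    by rewrite mul0r.
  by rewrite mulr0.
move=> yr1; have {yr1} yr1 := eqP yr1.
(* Each of p, q, r annihilates both y and z, so whichever of them is nonzero can be cancelled. *)
have py : p * y = 0 by lra.
have pz : p * z = 0 by lra.
have qz : q * z = 0 by lra.
have qy : q * y = 0 by rewrite mulrC -xp.
have ry : r * y = 0 by rewrite mulrC.
have rz : r * z = 0 by rewrite mulrC zr.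
by split=> //; case/or3P: f0 => n0; split; apply: (mulfI n0); rewrite mulr0.
Qed.

(** Congruence by the matrix P that diagonalises [A] reduces this to [eta]. As [eta] is its own
    inverse, the inverse of [A] is P^T eta P. *)
Lemma stress_variation_eq0 A F H (c : R) : lorentzian A ->
  F^T = - F -> H^T = - H ->
  H *m invmx A *m F^T + F *m invmx A *m H^T = c *: A -> F != 0 -> H = 0.
Proof.
move=> [P uP PA] aF aH e F0.
have uT : P^T \in unitmx by rewrite unitmx_tr.
have etaK : eta *m eta = 1%:M.
  apply/matrixP => i j; rewrite mul_diag_mx !mxE.
  by case: (i == j); case: ifP => _; rewrite ?mulr1n ?mulr0n ?mulrNN ?mulr0 ?mulr1 //.
have uE : eta \in unitmx by apply: (mulmx1_unit etaK).1.
have uA : A \in unitmx.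
  by move: uE; rewrite /eta -PA !unitmx_mul uP uT andbT.
have ieta : invmx eta = eta.
  by rewrite -[LHS]mulmx1 -etaK mulKmx.
have iA : invmx A = P^T *m eta *m P.
  rewrite -[in RHS]ieta /eta -PA invmx_congr // !mulmxA trmx_inv.
  by rewrite mulmxV // mul1mx mulmxKV.
suff : P *m H *m P^T = 0.
  move=> /(congr1 (fun M => invmx P *m M *m invmx P^T)).
  by rewrite mulmx0 mul0mx !mulmxA mulVmx // mul1mx mulmxK.
apply: (@eta_sym_product_eq0 (P *m F *m P^T) _ c).
- by rewrite !trmx_mul trmxK aF mulNmx mulmxN mulmxA.
- by rewrite !trmx_mul trmxK aH mulNmx mulmxN mulmxA.
- have -> : c *: eta = P *m (c *: A) *m P^T.
    by rewrite /eta -PA -scalemxAr -scalemxAl.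
  rewrite -e mulmxDr mulmxDl iA.
  by rewrite !trmx_mul trmxK !mulmxA.
- apply: contra_neq F0 => /(congr1 (fun M => invmx P *m M *m invmx P^T)).
  by rewrite mulmx0 mul0mx !mulmxA mulVmx // mul1mx mulmxK.
Qed.

End StressAlgebra.

(** * Displacements that stay in the chart and preserve orientation *)

Section SmallDisplacements.
Context {R : realType}.

Lemma det_jacobian_displace (V : set 'rV[R]_3) (xi : 'rV[R]_3 -> 'rV[R]_3) t y :
  open V -> smooth_on V xi -> V y ->
  \det ('J (displace xi t) y) = \det (\matrix_(i, j) jac xi i j t y).
Proof.
move=> oV sxi Vy; congr (\det _); apply/matrixP => i j.
by rewrite [RHS]mxE (jacobian_displace oV sxi).
Qed.

(** The displaced point and the Jacobian determinant are jointly continuous in (t, y) at (0, x),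
    with values x and 1 there. A product neighbourhood of (0, x) then yields a bound on t that is
    uniform over V. *)
Lemma displace_nbhs (U : set 'rV[R]_3) (xi : 'rV[R]_3 -> 'rV[R]_3) x :
  open U -> smooth_on U xi -> U x ->
  exists (V : set 'rV[R]_3) (d : R), [/\ open V, V x, V `<=` U, 0 < d &
    forall t y, `|t| < d -> V y ->
      U (displace xi t y) /\ 0 < \det ('J (displace xi t) y)].
Proof.
move=> oU sxi Ux.
have c1 : p.1 @[p --> ((0 : R), x)] --> (0 : R) by exact: cvg_fst.
have c2 : p.2 @[p --> ((0 : R), x)] --> x by exact: cvg_snd.
have cU : displace xi p.1 p.2 @[p --> ((0 : R), x)] --> displace xi 0 x.
  apply: cvgD => //; apply: cvgZ => //.
  by apply: cvg_comp c2 _; exact: smooth_on_continuous sxi Ux.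
have cD : \det (\matrix_(i, j) jac xi i j p.1 p.2) @[p --> ((0 : R), x)]
    --> \det (\matrix_(i < 3, j < 3) jac xi i j 0 x).
  apply: (cvg_big (@add_continuous _)) => s _; apply: cvgM; first exact: cvg_cst.
  apply: (cvg_big (@mul_continuous _)) => i _.
  under eq_fun do rewrite mxE.
  rewrite mxE; apply: cvgD; first exact: cvg_cst.
  apply: cvgM => //; apply: cvg_comp c2 _.
  apply: smooth_on_continuous Ux; apply: smooth_on_pd.
  exact: smooth_on_coord.
have D1 : 0 < \det (\matrix_(i < 3, j < 3) jac xi i j 0 x).
  rewrite [X in \det X](_ : _ = 1%:M) ?det1 //.
  by apply/matrixP => i j; rewrite !mxE jac0.
have : \forall p \near ((0 : R), x),
    U (displace xi p.1 p.2) /\ 0 < \det (\matrix_(i, j) jac xi i j p.1 p.2).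
  apply: filterI; last exact: (cvgr_gt _ cD _ D1).
  apply: cU; rewrite displace0; exact: open_nbhs_nbhs.
move=> [[A B] /= [/nbhs_ballP[d /= d0 dA] nB] AB].
exists (U `&` interior B), d; split=> //.
- by apply: openI => //; exact: open_interior.
- move=> t y td [Uy By].
  have [] := AB (t, y).
    split=> /=; last exact: interior_subset.
    by apply: dA; rewrite -ball_normE /ball_/= sub0r normrN.
  by move=> UD D0; split=> //; rewrite (det_jacobian_displace t oU sxi).
Qed.

End SmallDisplacements.

(** * Derivatives at t = 0 of curves of matrices *)

Section MatrixCurves.
Context {R : realType}.

(** Stated entrywise, to match [variation], which concerns scalar functions. *)
Definition mx_derive m n (M : R -> 'M[R]_(m, n)) (M' : 'M[R]_(m, n)) : Prop :=
  forall i j, is_derive (0 : R) (1 : R) (fun t => M t i j) (M' i j).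

Lemma is_deriveMn (u v : R -> R) (u' v' : R) :
  is_derive (0 : R) (1 : R) u u' -> is_derive (0 : R) (1 : R) v v' ->
  is_derive (0 : R) (1 : R) (fun t => u t * v t : R) (u' * v 0 + u 0 * v').
Proof.
move=> du dv; apply: (is_derive_eq (is_deriveM du dv)).
by rewrite /GRing.scale /= addrC [_ * u']mulrC.
Qed.

Lemma is_derive_fsum (I : finType) (u : I -> R -> R) (u' : I -> R) :
  (forall i, is_derive (0 : R) (1 : R) (u i) (u' i)) ->
  is_derive (0 : R) (1 : R) (fun t => \sum_i u i t) (\sum_i u' i).
Proof.
move=> du; elim: (index_enum I) => [|i s IH].
  under eq_fun do rewrite big_nil.
  by rewrite big_nil; exact: is_derive_cst.
under eq_fun do rewrite big_cons.
by rewrite big_cons; exact: is_deriveD.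
Qed.

Lemma mx_deriveM m n p (M : R -> 'M[R]_(m, n)) M' (N : R -> 'M[R]_(n, p)) N' :
  mx_derive M M' -> mx_derive N N' ->
  mx_derive (fun t => M t *m N t) (M' *m N 0 + M 0 *m N').
Proof.
move=> dM dN i j.
have := is_derive_fsum (fun k => is_deriveMn (dM i k) (dN k j)).
have -> : (fun t => (M t *m N t) i j) = fun t => \sum_k M t i k * N t k j.
  by apply/funext => t; rewrite mxE.
by move=> /is_derive_eq; apply; rewrite big_split !mxE.
Qed.

Lemma mx_derive_tr m n (M : R -> 'M[R]_(m, n)) M' :
  mx_derive M M' -> mx_derive (fun t => (M t)^T) M'^T.
Proof.
move=> dM i j; rewrite mxE.
by under eq_fun do rewrite mxE; exact: dM.
Qed.

Lemma pairing_derive (M N : R -> 'M[R]_3) M' N' :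
  mx_derive M M' -> mx_derive N N' ->
  is_derive (0 : R) (1 : R) (fun t => pairing (M t) (N t))
    (pairing M' (N 0) + pairing (M 0) N').
Proof.
move=> dM dN; have := is_derive_fsum (fun c => is_derive_fsum (fun e =>
  is_deriveMn (dM c e) (dN c e))).
move=> /is_derive_eq; apply; rewrite /pairing -big_split.
by apply: eq_bigr => c _; rewrite -big_split.
Qed.

(** Metric and inverse metric are constant to first order, so only the two explicit factors F and
    the scalar F_cd F^cd contribute. The latter multiplies the metric, so its derivative is absorbed
    into c without being computed. *)
Lemma em_stress_derive (A F : R -> 'M[R]_3) H :
  mx_derive A 0 -> mx_derive (fun t => invmx (A t)) 0 -> mx_derive F H ->
  exists c : R, mx_derive (fun t => em_stress (A t) (F t))
    ((4 * pi)^-1 *: (H *m invmx (A 0) *m (F 0)^T + F 0 *m invmx (A 0) *m H^T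
      - c *: A 0)).
Proof.
move=> dA dG dF.
have dK := mx_deriveM (mx_deriveM dG dF) (mx_derive_tr dG).
have dS := pairing_derive dF dK.
have dFGF := mx_deriveM (mx_deriveM dF dG) (mx_derive_tr dF).
(* The t-derivative at 0 of F_cd F^cd. *)
set c0 := (X in is_derive _ _ _ X) in dS.
exists (4^-1 * c0) => i j.
have dc4 := is_deriveMn (is_derive_cst (4^-1 : R) (0 : R) (1 : R)) dS.
have := is_deriveMn (is_derive_cst ((4 * pi)^-1 : R) (0 : R) (1 : R))
  (is_deriveB (dFGF i j) (is_deriveMn dc4 (dA i j))).
set u := (X in is_derive _ _ X _).
have -> : (fun t => em_stress (A t) (F t) i j) = u.
  by apply/funext => t; rewrite /em_stress mxE [X in _ * X]mxE
    [X in _ + X]mxE [X in _ - X]mxE.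
move=> /is_derive_eq; apply; rewrite !mulmx0 addr0 /cst !mul0r !add0r.
rewrite [(0 : 'M[R]_3) i j]mxE mulr0 addr0 [RHS]mxE [X in _ = _ * X]mxE.
by rewrite [X in _ = _ * (_ + X)]mxE [X in _ = _ * (_ - X)]mxE.
Qed.

End MatrixCurves.

(** * Inheritance of the symmetry *)

Section InheritedSymmetry.
Context {R : realType} (U : set 'rV[R]_3) (oU : open U) (E : gravity_tensor R).
Context (g F : 'rV[R]_3 -> 'M[R]_3) (xi : 'rV[R]_3 -> 'rV[R]_3).
Context (g_metric : lorentz_metric_on U g).
Context (F_smooth : smooth_on U F).
Context (F_antisym : forall x, U x -> (F x)^T = - F x).
Context (xi_smooth : smooth_on U xi).
Context (xi_killing : forall x, U x -> lie2 xi g x = 0).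
Context (E_defined : forall x, U x -> gt_defined_at E g x).
Context (field_eq : forall x, U x ->
  gt_eval E g x = (8 * pi) *: em_stress (g x) (F x)).

Lemma lorentzian_unitmx (A : 'M[R]_3) : lorentzian A -> A \in unitmx.
Proof.
move=> [P uP PA]; suff : P *m A *m P^T \in unitmx.
  by rewrite !unitmx_mul => /andP[/andP[_ ->]].
rewrite PA unitmxE unitfE det_diag; apply/prodf_neq0 => i _.
by rewrite mxE; case: ifP; rewrite ?oppr_eq0 oner_eq0.
Qed.

Lemma pullback2_displace0 (T : 'rV[R]_3 -> 'M[R]_3) x : U x ->
  pullback2 (displace xi 0) T x = T x.
Proof.
move=> Ux; rewrite /pullback2 displace0.
have -> : 'J (displace xi 0) x = 1%:M.
  by apply/matrixP => i j; rewrite (jacobian_displace oU xi_smooth) // jac0 mxE.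
by rewrite trmx1 mulmx1 mul1mx.
Qed.

(** Chain rule with vanishing inner derivative: the differential of f sends 0 to 0, whatever it is.
    It will be applied to [gt_fun] along the curve of geometric data. *)
Lemma mx_derive_comp n m (f : 'rV[R]_n -> 'M[R]_m) (T : R -> 'rV[R]_n) :
  differentiable f (T 0) -> mx_derive T 0 -> mx_derive (f \o T) 0.
Proof.
move=> df dT.
have cT : derivable T 0 1.
  by apply/derivable_mxP => i j; exact: (@ex_derive _ _ _ _ _ _ _ (dT i j)).
have T0 : 'D_1 T 0 = 0.
  rewrite derive_mx //; apply/matrixP => i j; rewrite mxE.
  exact: (@derive_val _ _ _ _ _ _ _ (dT i j)).
have diT : differentiable T 0 by exact/derivable1_diffP.
have dfT : differentiable (f \o T) 0 by exact: differentiable_comp.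
have fT0 : 'D_1 (f \o T) 0 = 0.
  by rewrite deriveE // diff_comp //= -(deriveE _ diT) T0 linear0.
move=> i j; have cfT : derivable (f \o T) 0 1 by exact: diff_derivable.
apply: DeriveDef; first by move/derivable_mxP : cfT; exact.
by rewrite (derive_coord i j cfT) fT0.
Qed.

Lemma stress_variation x : U x -> exists c : R,
  lie2 xi F x *m invmx (g x) *m (F x)^T + F x *m invmx (g x) *m (lie2 xi F x)^T
    = c *: g x.
Proof.
move=> Ux; have [V [d [oV Vx VU d0 Vd]]] := displace_nbhs oU xi_smooth Ux.
have [sg lg] := g_metric.
have sxi : smooth_on V xi by exact: smooth_on_subset VU xi_smooth.
have VdU t y : `|t| < d -> V y -> U (displace xi t y) by move=> td /(Vd _ _ td)[].
pose G t := pullback2 (displace xi t) g.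
pose K t := pullback2 (displace xi t) F.
have uJ t y : `|t| < d -> V y -> 'J (displace xi t) y \in unitmx.
  by move=> td /(Vd _ _ td)[_ D0]; rewrite unitmxE unitfE gt_eqF.
have ug t y : `|t| < d -> V y -> g (displace xi t y) \in unitmx.
  by move=> td Vy; apply/lorentzian_unitmx/lg; exact: VdU.
have unitG t y : `|t| < d -> V y -> G t y \in unitmx.
  by move=> td Vy; rewrite !unitmx_mul unitmx_tr uJ // ug.
(* The Killing equation holds on all of V, so the first-order variation of the metric is the zero
   function there and its partial derivatives vanish too. *)
have stG a b : stationary V d (fun t y => G t y a b).
  move=> k; have := variation_pullback2 oU oV d0 sxi VdU k a b sg.
  by apply: variation_eq => // y /VU Uy; rewrite xi_killing // mxE.
have G0 : G 0 x = g x by exact: pullback2_displace0.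
have K0 : K 0 x = F x by exact: pullback2_displace0.
pose T t := geom_data (gt_order E) (G t) x.
have dT : mx_derive T 0.
  move=> i j; rewrite mxE /T /geom_data.
  have -> : (fun t => (\row_l geom_entry (G t) x (enum_val l)) i j)
      = (fun t => geom_entry (G t) x (enum_val j)).
    by apply/funext => t; rewrite mxE.
  exact: (is_derive_geom_entry oV d0 unitG stG).
(* Covariance expresses E of the pulled-back metric through E at the displaced point; there the
   field equation applies, and [em_stress_congr] carries the stress tensor back. *)
have cov t : `|t| < d -> gt_dom (T t) /\
    gt_fun (T t) = (8 * pi) *: em_stress (G t x) (K t x).
  move=> td; have [||t1 t2] := gt_covariant oU oV g_metric E_defined
    (smooth_on_displace oV sxi t) _ _ Vx.
  - by move=> y; exact: VdU.
  - by move=> y /(Vd _ _ td)[].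
  split=> //; rewrite t2 /G /K /pullback2 em_stress_congr; [|exact: uJ|exact: ug].
  rewrite /= [gt_fun _]field_eq; last exact: VdU.
  by rewrite -scalemxAr -scalemxAl.
have z0 : `|0 : R| < d by rewrite normr0.
have [dom0 _] := cov 0 z0.
have dE := mx_derive_comp (gt_differentiable dom0) dT.
have dG : mx_derive (fun t => G t x) 0.
  by move=> i j; rewrite mxE; exact: (variation_derive (stG i j 0%N) Vx).
have dI : mx_derive (fun t => invmx (G t x)) 0.
  move=> i j; rewrite mxE.
  exact: (variation_derive (stationary_invmx oV d0 unitG stG i j 0%N) Vx).
have dK : mx_derive (fun t => K t x) (lie2 xi F x).
  move=> i j.
  exact: (variation_derive (variation_pullback2 oU oV d0 sxi VdU 0 i j F_smooth) Vx).
have [c] := em_stress_derive dG dI dK; rewrite G0 K0 => dS.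
exists c; apply/eqP; rewrite -subr_eq0; apply/eqP/matrixP => i j.
have dS' := is_deriveMn (is_derive_cst (8 * pi : R) (0 : R) (1 : R)) (dS i j).
(* Both sides agree for |t| < d, so their derivatives at 0 agree: the gravitational side gives 0,
   the stress side a nonzero multiple of the wanted expression. *)
have e0 : \forall t \near (0 : R), (@gt_fun R E \o T) t i j
    = cst (8 * pi) t * em_stress (G t x) (K t x) i j.
  apply/nbhs_ballP; exists d => // t; rewrite -ball_normE /ball_/= sub0r normrN.
  by move=> /cov[_ ->]; rewrite mxE.
have := @derive_val _ _ _ _ _ _ _ (near_eq_is_derive e0 (dE i j)).
rewrite (@derive_val _ _ _ _ _ _ _ dS').
rewrite mul0r add0r /cst [X in _ * X]mxE mulrA [RHS]mxE => /eqP.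
have pi0 : (pi : R) != 0 by rewrite gt_eqF // pi_gt0.
have k0 : 8 * pi * (4 * pi)^-1 != 0 :> R.
  by rewrite mulf_neq0 ?invr_neq0 // mulf_neq0 // pnatr_eq0.
by rewrite mulf_eq0 (negbTE k0) => /eqP ->; rewrite [RHS]mxE.
Qed.

Lemma lie2_antisym x : U x -> (lie2 xi F x)^T = - lie2 xi F x.
Proof.
move=> Ux; apply/matrixP => a b; rewrite !mxE -sumrN; apply: eq_bigr => c _.
have aF y i j : U y -> F y i j = - F y j i.
  by move=> /F_antisym/matrixP/(_ j i); rewrite !mxE.
have -> : pd c (fun y => F y b a) x = - pd c (fun y => F y a b) x.
  rewrite -[RHS]deriveN; last first.
    exact: smooth_on_derivable (smooth_on_coord a b oU F_smooth) Ux.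
  by apply: (pd_eq _ oU _ Ux) => y Uy; exact: aF.
by rewrite (aF x c a Ux) (aF x b c Ux); ring.
Qed.

Lemma lie2_eq0_of_neq0 x : U x -> F x != 0 -> lie2 xi F x = 0.
Proof.
move=> Ux; have [c e] := stress_variation Ux; have [_ lg] := g_metric.
by apply: stress_variation_eq0 e; [exact: lg|exact: F_antisym|exact: lie2_antisym].
Qed.

Lemma lie2_continuous x a b : U x -> {for x, continuous (fun y => lie2 xi F y a b)}.
Proof.
move=> Ux.
have cF i j := smooth_on_continuous (smooth_on_coord i j oU F_smooth) Ux.
have cpF c i j := smooth_on_continuous
  (smooth_on_pd c (smooth_on_coord i j oU F_smooth)) Ux.
have cxi j := smooth_on_continuous (smooth_on_coord 0 j oU xi_smooth) Ux.
have cpxi c j := smooth_on_continuous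
  (smooth_on_pd c (smooth_on_coord 0 j oU xi_smooth)) Ux.
rewrite /prop_for /continuous_at mxE.
under eq_cvg do rewrite mxE.
apply: (@cvg_big _ _ _ _ _ (@add_continuous _) _ (nbhs x) _ _ _
  (nbhs_filter x)) => c _.
apply: cvgD; last by apply: cvgM; [exact: cpxi|exact: cF].
apply: cvgD; apply: cvgM.
- exact: cxi.
- exact: cpF.
- exact: cpxi.
- exact: cF.
Qed.

Lemma lie2_eq0 x : U x -> lie2 xi F x = 0.
Proof.
move=> Ux; apply/matrixP => a b; rewrite [RHS]mxE; apply/eqP; apply: contraT => H0.
have H0n : \forall y \near x, lie2 xi F y a b != 0.
  have H : lie2 xi F y a b @[y --> x] --> lie2 xi F x a b.
    exact: lie2_continuous.
  exact: (@cvgr_neq0 _ _ _ _ (nbhs_filter x) _ _ H H0).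
(* Contrapositive of [lie2_eq0_of_neq0], at each point near x. *)
have F0 : \forall y \near x, F y = 0.
  have Un : \forall y \near x, U y by exact: open_nbhs_nbhs.
  apply: filterS2 Un H0n => y Uy; apply: contraNeq => /(lie2_eq0_of_neq0 Uy) ->.
  by rewrite mxE.
have Fx : F x = 0 := nbhs_singleton F0.
suff e : lie2 xi F x a b = 0 by rewrite e eqxx in H0.
(* The value F x = 0 kills the two terms with derivatives of xi; the transport term needs F to
   vanish on a whole neighbourhood. *)
rewrite mxE big1 // => c _; rewrite Fx !mxE !mulr0 !addr0.
have -> : pd c (fun y => F y a b) x = pd c (fun=> 0 : R) x.
  by apply: near_eq_derive; apply: filterS F0 => y ->; rewrite mxE.
by rewrite /pd derive_cst mulr0.
Qed.

End InheritedSymmetry.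

Theorem theorem1 (R : realType) (M : oriented_manifold3 R)
    (g F : cov2_family M) (E : gravity_tensor R) (mu : R) (xi : vec_family M)
    (g_metric : lorentzian_metric g)
    (F_2form : smooth_2form F)
    (field_eq : gravity_eq E g F)
    (mcs_eq : maxwell_chern_simons mu g F)
    (xi_smooth : smooth_vector_field xi)
    (xi_killing : killing g xi)
    (xi_zeros : forall p : M,
       vanishes_at xi p -> frontier (lightlike_set g xi) p) :
  forall (i : atlas_index M) (x : 'rV[R]_3), cimg (atlas i) x ->
    lie2 (xi i) (F i) x = 0.
Proof.
move=> i x; have [[sg _] lg] := g_metric; have [[sF _] aF] := F_2form.
have [sxi _] := xi_smooth.
have Ed y : cimg (atlas i) y -> gt_defined_at E (g i) y by move=> /field_eq[].
have Ee y : cimg (atlas i) y ->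
    gt_eval E (g i) y = (8 * pi) *: em_stress (g i y) (F i y).
  by move=> /field_eq[].
(* The claim is local: the image of each chart is an open set on which the preceding lemma
   applies. *)
exact: (lie2_eq0 (@cimg_open _ _ (atlas i)) (conj (sg i) (lg i)) (sF i) (aF i)
  (sxi i) (xi_killing i) Ed Ee).
Qed.
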